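(* For every non-negative integer $N$, \[\sum_{\pi\in\mathcal{D}_{\le N}} q^{\mathcal{O}(\pi)} = \sum_{\pi\in\mathcal{RR}_{\le N}} \omega(\pi)\, q^{|\pi|},\] where for $\pi=(\lambda_1,\dots,\lambda_k)$ with $k\ge1$ parts, $\omega(\pi)=\lambda_k\prod_{i=1}^{k-1}(\lambda_i-\lambda_{i+1}-1)$, and $\omega(\emptyset)=1$.
   Context: A partition $\pi=(\lambda_1,\lambda_2,\dots)$ is a finite non-increasing sequence of positive integers; the empty sequence is the unique partition of $0$; $|\pi|$ is the sum of its parts. $\mathcal{D}_{\le N}$ is the set of partitions into distinct parts all $\le N$. $\mathcal{RR}_{\le N}$ is the set of partitions into parts $\le N$ in which consecutive parts differ by at least $2$. $\mathcal{O}(\pi)=\lambda_1+\lambda_3+\lambda_5+\cdots$. *)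

(* Defs.v *)
From mathcomp Require Import all_boot all_order all_algebra.
From mathcomp Require Import boolp classical_sets cardinality fsbigop.

Set Implicit Arguments.
Unset Strict Implicit.
Unset Printing Implicit Defensive.

Import GRing.Theory.
Local Open Scope classical_set_scope.
Local Open Scope ring_scope.

(* The sequence [:: l1; l2; ...] lists the parts in non-increasing order. *)
Definition is_partition (p : seq nat) : bool :=
  sorted geq p && all (fun l => 0 < l)%N p.

Definition parts_le (N : nat) (p : seq nat) : bool := all (fun l => l <= N)%N p.

Definition distinct_partitions (N : nat) : set (seq nat) :=
  [set p | [/\ is_partition p, uniq p & parts_le N p]].

Definition RR_partitions (N : nat) : set (seq nat) :=
  [set p | [/\ is_partition p, sorted (fun a b => b + 2 <= a)%N p
             & parts_le N p]].

(* Indices start at 0, so l1, l3, l5, ... are the entries of even index. *)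
Definition odd_index_sum (p : seq nat) : nat :=
  (\sum_(i < size p | ~~ odd i) nth 0 p i)%N.

Definition omega (p : seq nat) : int :=
  if p is [::] then 1
  else (last 0%N p)%:Z *
       \prod_(i < (size p).-1) ((nth 0%N p i)%:Z - (nth 0%N p i.+1)%:Z - 1).

(* \sum_(p \in A) is a genuine sum only over a finite support (it is 0
   otherwise); the next two lemmas show that both index sets are finite. *)
Lemma finite_distinct_partitions (N : nat) : finite_set (distinct_partitions N).
Proof.
pose f (b : N.+1.-bseq 'I_N.+1) : seq nat := [seq val i | i <- b].
apply: (@sub_finite_set _ _ (f @` [set: N.+1.-bseq 'I_N.+1])); last first.
  exact/finite_image/finite_finset.
move=> p [_ p_uniq /allP p_le].
have size_p : (size [seq inord i : 'I_N.+1 | i <- p] <= N.+1)%N.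
  rewrite size_map -(size_iota 0 N.+1); apply: uniq_leq_size => // i /p_le.
  by rewrite mem_iota add0n ltnS.
exists (Bseq size_p) => //; rewrite /f /= -map_comp -[RHS]map_id.
by apply/eq_in_map => i /p_le le_iN /=; rewrite inordK.
Qed.

Lemma RR_sub_distinct_partitions (N : nat) :
  RR_partitions N `<=` distinct_partitions N.
Proof.
move=> p [p_part p_gap p_le]; split=> //.
have gtn_trans : transitive gtn by move=> y x z /= yx zy; apply: ltn_trans yx.
apply: (sorted_uniq gtn_trans); first by move=> x /=; rewrite ltnn.
apply: sub_sorted p_gap => a b /=; apply: leq_trans.
by rewrite addn2.
Qed.

Lemma finite_RR_partitions (N : nat) : finite_set (RR_partitions N).
Proof.
exact: sub_finite_set (@RR_sub_distinct_partitions N)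
  (finite_distinct_partitions N).
Qed.

(* Main.v *)
(** Since [omega] vanishes on the partitions with two consecutive parts
    differing by exactly 1, the right-hand sum may be taken over all partitions
    into distinct parts <= N. Adjoining a largest part N + 1 to such partitions
    then gives the same recurrences
    [A (N + 1) = A N + q^(N + 1) * C N] and [C (N + 1) = C N + A N] for both
    sides: on the left C sums q^(lambda_2 + lambda_4 + ...), on the right it
    sums [omega (N + 1, pi)] q^|pi|. *)

Require Import Defs.
From mathcomp Require Import all_boot all_order all_algebra.
From mathcomp Require Import boolp classical_sets cardinality fsbigop.

Import GRing.Theory.
Local Open Scope ring_scope.

(** An explicit enumeration split by whether the part [m.+1] occurs, so that sums over it satisfy
    the recurrences by construction. *)
Fixpoint distinct_seqs (n : nat) : seq (seq nat) :=
  if n is m.+1 then distinct_seqs m ++ [seq m.+1 :: p | p <- distinct_seqs m]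
  else [:: [::]].

(** Starting the path at [n.+1] encodes both strict decrease and the bound [n] on the parts. *)
Lemma mem_distinct_seqs (n : nat) (p : seq nat) :
  (p \in distinct_seqs n) = path gtn n.+1 p && all (leq 1) p.
Proof.
elim: n p => [|n IHn] p /=.
  by case: p => [|[|a] p] //=; rewrite !andbF.
rewrite mem_cat; case: p => [|a p] /=; first by rewrite IHn.
rewrite IHn /= (ltnS a n.+1) (leq_eqVlt a n.+1).
case: (ltngtP a n.+1) => [lt_an|lt_na|->] /=.
- case: mapP => [[s _ [a_eq _]]|_]; last by rewrite orbF.
  by rewrite a_eq ltnn in lt_an.
- by apply/negP => /mapP[s _ [a_eq _]]; rewrite a_eq ltnn in lt_na.
- by rewrite mem_map ?IHn // => s t [].
Qed.

Lemma distinct_seqs_uniq (n : nat) : uniq (distinct_seqs n).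
Proof.
elim: n => // n IHn /=; rewrite cat_uniq IHn map_inj_uniq ?IHn ?andbT //=.
  apply/hasPn => _ /mapP[p _ ->].
  by rewrite mem_distinct_seqs /= ltnn.
by move=> s t [].
Qed.

Lemma distinct_partitionsE (n : nat) :
  distinct_partitions n = [set` distinct_seqs n]%classic.
Proof.
have gtn_trans : transitive gtn by move=> y x z /= yx zy; apply: ltn_trans yx.
apply/seteqP; split=> p /=.
- move=> [/andP[p_sorted p_pos] p_uniq p_le].
  rewrite mem_distinct_seqs p_pos andbT path_sortedE //.
  by rewrite gtn_sorted_uniq_geq p_uniq p_sorted !andbT.
- rewrite mem_distinct_seqs path_sortedE // gtn_sorted_uniq_geq.
  by case/andP=> /and3P[p_le p_uniq p_sorted] p_pos; split=> //; apply/andP.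
Qed.

(** Prepending a part flips the parity of every index; dropping the head of [p] flips it back. *)
Lemma odd_index_sum_cons (a : nat) (p : seq nat) :
  odd_index_sum (a :: p) = (a + odd_index_sum (behead p))%N.
Proof.
rewrite /odd_index_sum big_mkcond big_ord_recl /=; congr addn.
case: p => [|b p] /=; first by rewrite !big_ord0.
rewrite big_ord_recl add0n [RHS]big_mkcond.
by apply: eq_bigr => i _ /=; rewrite negbK.
Qed.

#[local] Arguments omega : simpl never.

Lemma omega_cons2 (a b : nat) (p : seq nat) :
  omega [:: a, b & p] = (a%:Z - b%:Z - 1) * omega (b :: p).
Proof. by rewrite /omega /= big_ord_recl /= mulrCA. Qed.

Lemma omega_cons_consecutive (n : nat) (p : seq nat) :
  omega [:: n.+1, n & p] = 0.
Proof. by rewrite omega_cons2 -addn1 PoszD addrAC addrK subrr mul0r. Qed.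

Lemma omega_eq0 (p : seq nat) :
  sorted gtn p -> ~~ sorted (fun a b => b + 2 <= a)%N p -> omega p = 0.
Proof.
elim: p => // a [|b p] // IHp /andP[lt_ba p_gt]; rewrite [sorted _ _]/=.
case: (leqP (b + 2) a) => [_ p_gap|le_ab _].
  by rewrite omega_cons2 IHp ?mulr0.
(* A violated gap condition, [a < b + 2], together with [b < a] leaves only this value. *)
have -> : a = b.+1.
  by apply/anti_leq; rewrite -ltnS -addn2 le_ab; exact: lt_ba.
exact: omega_cons_consecutive.
Qed.

(** Raising the largest part by 1 raises only the first factor, by exactly 1, and the remaining
    factors form [omega p]. *)
Lemma omega_consS (n : nat) (p : seq nat) :
  omega (n.+1 :: p) = omega (n :: p) + omega p.
Proof.
case: p => [|b p]; first by rewrite /omega /= !big_ord0 !mulr1 -addn1 PoszD.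
rewrite !omega_cons2 -[X in _ = _ + X]mul1r -mulrDl subrK.
by rewrite -addn1 PoszD (addrAC n%:Z) addrK.
Qed.

Lemma odd_index_sum_omega (n : nat) :
  \sum_(p <- distinct_seqs n) ('X^(odd_index_sum p) : {poly int})
    = \sum_(p <- distinct_seqs n) omega p *: 'X^(sumn p) /\
  \sum_(p <- distinct_seqs n) ('X^(odd_index_sum (behead p)) : {poly int})
    = \sum_(p <- distinct_seqs n) omega (n.+1 :: p) *: 'X^(sumn p).
Proof.
elim: n => [|n [IHA IHC]] /=.
  by rewrite !big_seq1 /odd_index_sum /omega /= !big_ord0 !mulr1 !scale1r.
rewrite !big_cat !big_map /=; split.
- rewrite IHA; congr (_ + _).
  under eq_bigr => p _ do rewrite odd_index_sum_cons exprD.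
  under [RHS]eq_bigr => p _ do rewrite exprD scalerAr.
  by rewrite -!mulr_sumr IHC.
- rewrite IHA IHC -big_split /=.
  (* Sequences containing [n.+1] drop out on the right, since [n.+2] is put in front of them; the
     rest supply both sums through [omega_consS]. *)
  rewrite [X in _ = _ + X]big1 ?addr0; last first.
    by move=> p _; rewrite omega_cons_consecutive scale0r.
  by apply: eq_bigr => p _; rewrite -scalerDl -omega_consS.
Qed.

Theorem theorem6p2 (N : nat) :
  \sum_(p \in distinct_partitions N) ('X^(odd_index_sum p) : {poly int})
  = \sum_(p \in RR_partitions N) (omega p *: 'X^(sumn p) : {poly int}).
Proof.
rewrite (fsbig_widen _ _ _ (@RR_sub_distinct_partitions N)); last first.
  move=> p /= [[p_part p_uniq p_le] p_notRR].
  rewrite omega_eq0 ?scale0r //.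
    by case/andP: p_part => p_sorted _; rewrite gtn_sorted_uniq_geq p_uniq.
  by apply/negP => p_gap; apply: p_notRR.
rewrite distinct_partitionsE -!fsbig_seq ?distinct_seqs_uniq //.
by case: (odd_index_sum_omega N).
Qed.
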